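(* For every axiomatic extension $\vdash$ of $\mathbf{R^t}$, the following conditions are equivalent: $\vdash$ has an inconsistency lemma; $\vdash$ has a weak excluded middle law (WEML); $\vdash$ is algebraized by a Kollár variety of De Morgan monoids.
   Context: De Morgan monoids. A De Morgan monoid is an algebra $\boldsymbol{A}=\langle A;\cdot,\wedge,\vee,\neg,e\rangle$ comprising a distributive lattice $\langle A;\wedge,\vee\rangle$ (with order $\leqslant$), a commutative monoid $\langle A;\cdot,e\rangle$ that is square-increasing ($x\leqslant x\cdot x$), and a unary operation $\neg$ with $\neg\neg x=x$ and $x\cdot y\leqslant z\iff x\cdot\neg z\leqslant\neg y$. The class $\mathsf{DMM}$ of all De Morgan monoids is a variety. For $\boldsymbol{A}\in\mathsf{DMM}$ let $[e)=\{a\in A:e\leqslant a\}$. The logic. Formulas are terms in the signature $\cdot,\wedge,\vee,\neg,e$ over an infinite set of variables; $\mathit{Fm}$ is the set of formulas, $\boldsymbol{Fm}$ the absolutely free algebra of formulas. A deductive system is a finitary, substitution-invariant consequence relation from sets of formulas to formulas (reflexive and transitive in the usual sense). $\mathbf{R^t}$ is identified with the deductive system $\vdash_{\mathbf{R^t}}$ given by: $\Gamma\vdash_{\mathbf{R^t}}\alpha$ iff for every $\boldsymbol{A}\in\mathsf{DMM}$ and every homomorphism $h\colon\boldsymbol{Fm}\to\boldsymbol{A}$, if $h[\Gamma]\subseteq[e)$ then $h(\alpha)\in[e)$ (the consequence relation of the class of matrices $\langle\boldsymbol{A},[e)\rangle$, $\boldsymbol{A}\in\mathsf{DMM}$). An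 axiomatic extension of $\vdash_{\mathbf{R^t}}$ is a deductive system $\vdash$ for which there is a set $\Delta$ of formulas, closed under substitution, with $\Gamma\vdash\alpha$ iff $\Gamma\cup\Delta\vdash_{\mathbf{R^t}}\alpha$. Algebraization. Algebras are non-empty. A $\vdash$-filter of an algebra $\boldsymbol{A}$ is a set $F\subseteq A$ such that whenever $\Gamma\vdash\alpha$ and $h\colon\boldsymbol{Fm}\to\boldsymbol{A}$ is a homomorphism with $h[\Gamma]\subseteq F$, then $h(\alpha)\in F$. $\Omega^{\boldsymbol{A}}F$ is the largest congruence of $\boldsymbol{A}$ for which $F$ is a union of congruence classes. For a variety $\mathsf{K}$, the $\mathsf{K}$-congruences of $\boldsymbol{A}$ are the congruences $\theta$ with $\boldsymbol{A}/\theta\in\mathsf{K}$. $\vdash$ is algebraized by $\mathsf{K}$ if, for every algebra $\boldsymbol{A}$ of the signature, $F\mapsto\Omega^{\boldsymbol{A}}F$ is an isomorphism from the lattice of $\vdash$-filters of $\boldsymbol{A}$ onto the lattice of $\mathsf{K}$-congruences of $\boldsymbol{A}$ (both ordered by inclusion). A variety $\mathsf{K}$ is a Kollár variety if $A\times A$ is compact in the congruence lattice of $\boldsymbol{A}$ for all $\boldsymbol{A}\in\mathsf{K}$; equivalently (a known theorem), no nontrivial (i.e., more than one-element) member of $\mathsf{K}$ has a trivial (one-element) subalgebra. Inconsistency lemma and WEML. $\Gamma\vdash\Pi$ means $\Gamma\vdash\alpha$ for all $\alpha\in\Pi$. Let $v_1,v_2,\dots$ be a fixed sequence of distinct variables,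 $\mathbb{N}^+=\{1,2,\dots\}$, and $\mathit{Fm}(n)$ the set of formulas whose variables are among $v_1,\dots,v_n$. For $\Psi\subseteq\mathit{Fm}(n)$, $\Psi(\alpha_1,\dots,\alpha_n)$ is the result of substituting $\alpha_i$ for $v_i$ in all members of $\Psi$. A set $\Xi$ of formulas is inconsistent in $\vdash$ if $\Xi\vdash\alpha$ for all $\alpha\in\mathit{Fm}$. An elementary IL-sequence for $\vdash$ is a family $\{\Psi_n:n\in\mathbb{N}^+\}$ of finite sets $\Psi_n\subseteq\mathit{Fm}(n)$ such that for all $n\in\mathbb{N}^+$ and all $\Gamma\cup\{\alpha_1,\dots,\alpha_n\}\subseteq\mathit{Fm}$: $\Gamma\cup\{\alpha_1,\dots,\alpha_n\}$ is inconsistent in $\vdash$ iff $\Gamma\vdash\Psi_n(\alpha_1,\dots,\alpha_n)$. $\vdash$ has an inconsistency lemma if it has an elementary IL-sequence. Given such a sequence, let $\#n=|\Psi_n|$, $\Psi_n=\{\psi_n^1,\dots,\psi_n^{\#n}\}$ and $\Psi_{\#n}\Psi_n=\Psi_{\#n}(\psi_n^1,\dots,\psi_n^{\#n})\subseteq\mathit{Fm}(n)$ (the order of enumeration is immaterial up to interderivability). $\vdash$ has a WEML if it has an elementary IL-sequence $\{\Psi_n\}$ such that for all $n\in\mathbb{N}^+$ and all $\Gamma\cup\{\alpha_1,\dots,\alpha_n,\varphi\}\subseteq\mathit{Fm}$: if $\Gamma\cup\Psi_n(\alpha_1,\dots,\alpha_n)\vdash\varphi$ and $\Gamma\cup\Psi_{\#n}\Psi_n(\alpha_1,\dots,\alpha_n)\vdash\varphi$,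 then $\Gamma\vdash\varphi$. (If $\Psi_n=\emptyset$, this condition for $n$ is trivially true.) *)

(* Defs.v *)
From HB Require Import structures.
From mathcomp Require Import all_boot finmap.
From mathcomp Require Import boolp classical_sets cardinality.

Set Implicit Arguments.
Unset Strict Implicit.
Unset Printing Implicit Defensive.

Local Open Scope classical_set_scope.

(* Algebras are automatically non-empty, because of the constant [cst]. *)
Record algebra := Algebra {
  carrier :> Type;
  mul : carrier -> carrier -> carrier;
  meet : carrier -> carrier -> carrier;
  join : carrier -> carrier -> carrier;
  neg : carrier -> carrier;
  cst : carrier }.

Arguments cst {a}.

Record hom (A B : algebra) := Hom {
  hom_fun :> A -> B;
  hom_mul : {morph hom_fun : x y / mul x y >-> mul x y};
  hom_meet : {morph hom_fun : x y / meet x y >-> meet x y};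
  hom_join : {morph hom_fun : x y / join x y >-> join x y};
  hom_neg : {morph hom_fun : x / neg x >-> neg x};
  hom_cst : hom_fun cst = cst }.

Record congruence (A : algebra) := Congruence {
  cong_rel :> A -> A -> Prop;
  cong_refl : forall x, cong_rel x x;
  cong_sym : forall x y, cong_rel x y -> cong_rel y x;
  cong_trans : forall x y z, cong_rel x y -> cong_rel y z -> cong_rel x z;
  cong_mul : forall x x' y y',
    cong_rel x x' -> cong_rel y y' -> cong_rel (mul x y) (mul x' y');
  cong_meet : forall x x' y y',
    cong_rel x x' -> cong_rel y y' -> cong_rel (meet x y) (meet x' y');
  cong_join : forall x x' y y',
    cong_rel x x' -> cong_rel y y' -> cong_rel (join x y) (join x' y');
  cong_neg : forall x x', cong_rel x x' -> cong_rel (neg x) (neg x') }.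

Definition cong_le (A : algebra) (s t : congruence A) : Prop :=
  forall x y, s x y -> t x y.

Definition cong_eq (A : algebra) (s t : congruence A) : Prop :=
  forall x y, s x y <-> t x y.

(* Elements of the quotient are equivalence classes, and the operations act on
   classes by x/t . y/t = (x . y)/t. *)
Section Quotient.
Variables (A : algebra) (t : congruence A).

Definition quot_carrier : Type := {C : set A | exists a, C = [set x | t a x]}.

Definition cls (a : A) : quot_carrier :=
  exist _ [set x | t a x] (ex_intro _ a erefl).

Lemma cls_eq (a b : A) : t a b -> [set x | t a x] = [set x | t b x].
Proof.
move=> tab; apply/seteqP; split => x /=.
- by apply: cong_trans; apply: cong_sym.
- exact: cong_trans.
Qed.

Lemma lift1_subproof (f : A -> A)
    (fP : forall x x', t x x' -> t (f x) (f x')) (C : quot_carrier) :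
  exists a, [set z | exists2 x, sval C x & t (f x) z] = [set z | t a z].
Proof.
case: C => C [a /= ->]; exists (f a); apply/seteqP; split => z /=.
- by case=> x tax; apply: cong_trans; apply: fP.
- by move=> ?; exists a => //; apply: cong_refl.
Qed.

Definition lift1 (f : A -> A) fP (C : quot_carrier) : quot_carrier :=
  exist _ _ (@lift1_subproof f fP C).

Lemma lift2_subproof (f : A -> A -> A)
    (fP : forall x x' y y', t x x' -> t y y' -> t (f x y) (f x' y'))
    (C D : quot_carrier) :
  exists a, [set z | exists x y, [/\ sval C x, sval D y & t (f x y) z]]
    = [set z | t a z].
Proof.
case: C D => C [a /= ->] [D [b /= ->]]; exists (f a b).
apply/seteqP; split => z /=.
- by case=> x [y [tax tby]]; apply: cong_trans; apply: fP.
- by move=> ?; exists a, b; split => //; apply: cong_refl.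
Qed.

Definition lift2 (f : A -> A -> A) fP (C D : quot_carrier) : quot_carrier :=
  exist _ _ (@lift2_subproof f fP C D).

Definition quotient : algebra :=
  @Algebra quot_carrier
    (lift2 (@cong_mul _ t)) (lift2 (@cong_meet _ t)) (lift2 (@cong_join _ t))
    (lift1 (@cong_neg _ t)) (cls cst).

Lemma cls_eqP (a b : A) : cls a = cls b <-> t a b.
Proof.
split=> [/(congr1 sval)/= /seteqP[_ /(_ b)] | tab]; last first.
  exact/eq_exist/cls_eq.
by apply; apply: cong_refl.
Qed.

Lemma lift1E (f : A -> A) fP (a : A) : @lift1 f fP (cls a) = cls (f a).
Proof.
apply: eq_exist; apply/seteqP; split => z /=.
- by case=> x tax; apply: cong_trans; apply: fP.
- by move=> ?; exists a => //; apply: cong_refl.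
Qed.

Lemma lift2E (f : A -> A -> A) fP (a b : A) :
  @lift2 f fP (cls a) (cls b) = cls (f a b).
Proof.
apply: eq_exist; apply/seteqP; split => z /=.
- by case=> x [y [tax tby]]; apply: cong_trans; apply: fP.
- by move=> ?; exists a, b; split => //; apply: cong_refl.
Qed.

Definition quot_hom : hom A quotient :=
  @Hom A quotient cls
    (fun a b => esym (lift2E (@cong_mul _ t) a b))
    (fun a b => esym (lift2E (@cong_meet _ t) a b))
    (fun a b => esym (lift2E (@cong_join _ t) a b))
    (fun a => esym (lift1E (@cong_neg _ t) a)) erefl.

End Quotient.

Section Leibniz.
Variables (A : algebra) (F : set A).

(* F is a union of t-classes *)
Definition compatible (t : congruence A) : Prop :=
  forall x y, t x y -> F x -> F y.

Definition leibniz_rel (x y : A) : Prop :=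
  exists2 t : congruence A, compatible t & t x y.

(* The translations serve only to prove that [leibniz_rel] is a compatible
   congruence. *)
Inductive translation : (A -> A) -> Prop :=
| tr_id : translation id
| tr_mull p c : translation p -> translation (fun x => p (mul c x))
| tr_mulr p c : translation p -> translation (fun x => p (mul x c))
| tr_meetl p c : translation p -> translation (fun x => p (meet c x))
| tr_meetr p c : translation p -> translation (fun x => p (meet x c))
| tr_joinl p c : translation p -> translation (fun x => p (join c x))
| tr_joinr p c : translation p -> translation (fun x => p (join x c))
| tr_neg p : translation p -> translation (fun x => p (neg x)).

Definition tr_rel (x y : A) : Prop :=
  forall p, translation p -> (F (p x) <-> F (p y)).

Lemma tr_rel_trans x y z : tr_rel x y -> tr_rel y z -> tr_rel x z.
Proof. by move=> xy yz p Tp; apply: iff_trans (xy p Tp) (yz p Tp). Qed.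

Definition tr_cong : congruence A.
Proof.
exists tr_rel.
- by [].
- by move=> x y xy p Tp; apply: iff_sym; apply: xy.
- exact: tr_rel_trans.
- move=> x x' y y' xx yy; apply: (@tr_rel_trans _ (mul x' y)) => p Tp.
  + exact: (xx _ (tr_mulr y Tp)).
  + exact: (yy _ (tr_mull x' Tp)).
- move=> x x' y y' xx yy; apply: (@tr_rel_trans _ (meet x' y)) => p Tp.
  + exact: (xx _ (tr_meetr y Tp)).
  + exact: (yy _ (tr_meetl x' Tp)).
- move=> x x' y y' xx yy; apply: (@tr_rel_trans _ (join x' y)) => p Tp.
  + exact: (xx _ (tr_joinr y Tp)).
  + exact: (yy _ (tr_joinl x' Tp)).
- by move=> x x' xx p Tp; apply: (xx _ (tr_neg Tp)).
Defined.

Lemma tr_cong_compatible : compatible tr_cong.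
Proof. by move=> x y xy; apply: (xy _ tr_id).1. Qed.

Lemma leibniz_relE x y : leibniz_rel x y <-> tr_rel x y.
Proof.
split=> [[t tF txy] p Tp|xy]; last first.
  by exists tr_cong; first exact: tr_cong_compatible.
have : t (p x) (p y).
  elim: Tp x y txy => // [q c|q c|q c|q c|q c|q c|q] _ IH x y xy; apply: IH;
    do ?[exact: cong_refl | exact: xy | apply: cong_mul | apply: cong_meet
        | apply: cong_join | apply: cong_neg].
by move=> txy'; split; apply: tF => //; apply: cong_sym.
Qed.

Definition leibniz : congruence A.
Proof.
exists leibniz_rel.
- by move=> x; apply/leibniz_relE; apply: (cong_refl tr_cong).
- by move=> x y /leibniz_relE xy; apply/leibniz_relE; apply: (cong_sym (c := tr_cong)).
- move=> x y z /leibniz_relE xy /leibniz_relE yz; apply/leibniz_relE.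
  exact: tr_rel_trans xy yz.
- move=> x x' y y' /leibniz_relE xx /leibniz_relE yy; apply/leibniz_relE.
  exact: (cong_mul (c := tr_cong)).
- move=> x x' y y' /leibniz_relE xx /leibniz_relE yy; apply/leibniz_relE.
  exact: (cong_meet (c := tr_cong)).
- move=> x x' y y' /leibniz_relE xx /leibniz_relE yy; apply/leibniz_relE.
  exact: (cong_join (c := tr_cong)).
- move=> x x' /leibniz_relE xx; apply/leibniz_relE.
  exact: (cong_neg (c := tr_cong)).
Defined.

Lemma leibniz_compatible : compatible leibniz.
Proof. by move=> x y [t tF txy]; apply: tF txy. Qed.

Lemma leibniz_largest (t : congruence A) : compatible t -> cong_le t leibniz.
Proof. by move=> tF x y txy; exists t. Qed.

End Leibniz.

Definition leA (A : algebra) (x y : A) : Prop := meet x y = x.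

Record DMM (A : algebra) : Prop := {
  meetA : associative (@meet A);
  meetC : commutative (@meet A);
  joinA : associative (@join A);
  joinC : commutative (@join A);
  meetKj : forall x y : A, meet x (join x y) = x;
  joinKm : forall x y : A, join x (meet x y) = x;
  meet_joinr : right_distributive (@meet A) (@join A);
  mulA : associative (@mul A);
  mulC : commutative (@mul A);
  mul1 : left_id cst (@mul A);
  square_increasing : forall x : A, leA x (mul x x);
  negK : involutive (@neg A);
  mul_le_neg : forall x y z : A,
    leA (mul x y) z <-> leA (mul x (neg z)) (neg y) }.

Definition up_e (A : algebra) : set A := [set a | leA cst a].
Arguments up_e : clear implicits.

(* the join of S in the congruence lattice, i.e., the congruence generated by
   the union of S *)
Definition cong_sup (A : algebra) (S : set (congruence A)) : congruence A.
Proof.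
exists (fun x y => forall t : congruence A,
  (forall s, S s -> cong_le s t) -> t x y).
- by move=> x t _; apply: cong_refl.
- by move=> x y xy t St; apply: cong_sym; apply: xy.
- by move=> x y z xy yz t St; apply: cong_trans (xy t St) (yz t St).
- by move=> x x' y y' xx yy t St; apply: cong_mul; [apply: xx|apply: yy].
- by move=> x x' y y' xx yy t St; apply: cong_meet; [apply: xx|apply: yy].
- by move=> x x' y y' xx yy t St; apply: cong_join; [apply: xx|apply: yy].
- by move=> x x' xx t St; apply: cong_neg; apply: xx.
Defined.

Definition cong_total (A : algebra) : congruence A :=
  @Congruence A (fun _ _ => True)
    (fun _ => I) (fun _ _ _ => I) (fun _ _ _ _ _ => I)
    (fun _ _ _ _ _ _ => I) (fun _ _ _ _ _ _ => I) (fun _ _ _ _ _ _ => I)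
    (fun _ _ _ => I).

Definition cong_compact (A : algebra) (c : congruence A) : Prop :=
  forall S : set (congruence A), cong_le c (cong_sup S) ->
  exists T : set (congruence A),
    [/\ T `<=` S, finite_set T & cong_le c (cong_sup T)].

Definition kollar (K : algebra -> Prop) : Prop :=
  forall A, K A -> cong_compact (cong_total A).

Inductive Fm (V : Type) : Type :=
| fvar of V
| fmul of Fm V & Fm V
| fmeet of Fm V & Fm V
| fjoin of Fm V & Fm V
| fneg of Fm V
| fcst.

Arguments fcst {V}.

HB.instance Definition _ (V : Type) := gen_eqMixin (Fm V).
HB.instance Definition _ (V : Type) := gen_choiceMixin (Fm V).

Definition Fm_alg (V : Type) : algebra :=
  @Algebra (Fm V) (@fmul V) (@fmeet V) (@fjoin V) (@fneg V) fcst.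

Fixpoint fm_eval (V : Type) (A : algebra) (s : V -> A) (f : Fm V) : A :=
  match f with
  | fvar x => s x
  | fmul f g => mul (fm_eval s f) (fm_eval s g)
  | fmeet f g => meet (fm_eval s f) (fm_eval s g)
  | fjoin f g => join (fm_eval s f) (fm_eval s g)
  | fneg f => neg (fm_eval s f)
  | fcst => cst
  end.

Definition fm_ext (V : Type) (A : algebra) (s : V -> A) : hom (Fm_alg V) A :=
  @Hom (Fm_alg V) A (fm_eval s)
    (fun _ _ => erefl) (fun _ _ => erefl) (fun _ _ => erefl)
    (fun _ => erefl) erefl.

Fixpoint fm_vars (V : Type) (f : Fm V) : set V :=
  match f with
  | fvar x => [set x]
  | fmul f g | fmeet f g | fjoin f g => fm_vars f `|` fm_vars g
  | fneg f => fm_vars f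
  | fcst => set0
  end.

Section Logic.
Variable V : Type.
Implicit Types (G : set (Fm V)) (a : Fm V) (D : set (Fm V) -> Fm V -> Prop).

(* Varieties are equational classes. *)
Definition variety (K : algebra -> Prop) : Prop :=
  exists E : set (Fm V * Fm V), forall A : algebra,
    K A <-> forall s t, E (s, t) -> forall h : hom (Fm_alg V) A, h s = h t.

Record deductive_system D : Prop := {
  ds_refl : forall G a, G a -> D G a;
  ds_trans : forall G G' a, (forall b, G' b -> D G b) -> D G' a -> D G a;
  ds_finitary : forall G a, D G a ->
    exists G' : set (Fm V), [/\ G' `<=` G, finite_set G' & D G' a];
  ds_subst : forall (h : hom (Fm_alg V) (Fm_alg V)) G a,
    D G a -> D (h @` G) (h a) }.

Definition Rt G a : Prop :=
  forall A : algebra, DMM A -> forall h : hom (Fm_alg V) A,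
    h @` G `<=` up_e A -> up_e A (h a).

Definition subst_closed (X : set (Fm V)) : Prop :=
  forall (h : hom (Fm_alg V) (Fm_alg V)) a, X a -> X (h a).

Definition axiomatic_extension_of_Rt D : Prop :=
  deductive_system D /\
  exists2 X : set (Fm V), subst_closed X &
    forall G a, D G a <-> Rt (G `|` X) a.

Definition is_filter D (A : algebra) (F : set A) : Prop :=
  forall G a (h : hom (Fm_alg V) A), D G a -> h @` G `<=` F -> F (h a).

(* An isomorphism between lattices ordered by inclusion is a surjective order
   embedding. *)
Definition algebraized D (K : algebra -> Prop) : Prop :=
  forall A : algebra,
  [/\ forall F : set A, is_filter D F -> K (quotient (leibniz F)),
      forall F F' : set A, is_filter D F -> is_filter D F' ->
        (F `<=` F' <-> cong_le (leibniz F) (leibniz F'))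
    & forall t : congruence A, K (quotient t) ->
        exists2 F : set A, is_filter D F & cong_eq (leibniz F) t].

Definition algebraized_by_kollar_variety_of_DMM D : Prop :=
  exists K : algebra -> Prop,
    [/\ variety K, (forall A, K A -> DMM A), kollar K & algebraized D K].

Definition entails D G G' : Prop := forall a, G' a -> D G a.

Definition inconsistent D G : Prop := forall a, D G a.

(* The indexing is shifted by one: v_1, v_2, ... are [v 0], [v 1], ... *)
Variable v : nat -> V.

Definition Fm_ (n : nat) : set (Fm V) :=
  [set a | fm_vars a `<=` [set v i | i in `I_n]].

(* the substitution v_i |-> a_i (1 <= i <= n), identity on other variables *)
Definition subst_tuple (n : nat) (a : n.-tuple (Fm V)) (x : V) : Fm V :=
  if [pick i : 'I_n | `[< v i = x >]] is Some i then tnth a i else fvar x.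

(* X(a_1, ..., a_n) *)
Definition inst (X : set (Fm V)) (n : nat) (a : n.-tuple (Fm V)) :
  set (Fm V) := fm_ext (A := Fm_alg V) (subst_tuple a) @` X.

(* Only the values of Psi at n > 0 are constrained. *)
Definition elementary_IL_sequence D (Psi : nat -> {fset Fm V}) : Prop :=
  forall n, (0 < n)%N ->
    [set` Psi n] `<=` Fm_ n /\
    forall G (a : n.-tuple (Fm V)),
      inconsistent D (G `|` [set` a]) <-> entails D G (inst [set` Psi n] a).

Definition has_IL D : Prop :=
  exists Psi : nat -> {fset Fm V}, elementary_IL_sequence D Psi.

(* Psi_(#n) Psi_n, with Psi_n enumerated by the underlying duplicate-free
   sequence of the finite set, whose length #n is its cardinality. *)
Definition PsiPsi (Psi : nat -> {fset Fm V}) (n : nat) : set (Fm V) :=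
  inst [set` Psi #|` Psi n|%fset] (in_tuple (Psi n)).

(* If Psi n is empty, PsiPsi refers to the unconstrained Psi 0, but then the
   first premise already is the conclusion. *)
Definition has_WEML D : Prop :=
  exists2 Psi : nat -> {fset Fm V}, elementary_IL_sequence D Psi &
    forall n, (0 < n)%N -> forall G (a : n.-tuple (Fm V)) (f : Fm V),
      D (G `|` inst [set` Psi n] a) f ->
      D (G `|` inst (PsiPsi Psi n) a) f ->
      D G f.

End Logic.

(* Main.v *)
From mathcomp Require Import all_boot finmap.
From mathcomp Require Import boolp classical_sets cardinality.
Require Import Defs.

(** A De Morgan monoid sees the formula [absurd], i.e., [e ⇔ f] with [f = ∼ e],
    as designated exactly when [{e}] is a subalgebra. All three conditions
    amount to saying that [absurd] is inconsistent in the extension.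

    Let [Ax] be the axioms of the extension. It is algebraized by the variety of
    those De Morgan monoids in which [Ax] is designated ([models_variety],
    [models_algebraize]): a set [F] closed under the logic has the Leibniz
    congruence [x ⇔ y ∈ F], because quasi-identities of De Morgan monoids become
    closure properties of [F].

    From an inconsistency lemma one gets a finite inconsistent set, and then by
    substitution a finite inconsistent set of variable-free formulas. In a model
    with [e = f] these all take the value [e], so such a model is trivial
    ([no_trivial_subalgebra_of_IL]); as congruence generation is finitary, the
    total congruence is then compact in every model
    ([kollar_of_no_trivial_subalgebra]).

    Conversely, suppose that a Kollár variety contains a nontrivial [A] with
    [e = f]. The sequences in [A] that are eventually [e] form a member whose
    total congruence is the union of a chain of proper ones, which is impossible
    ([no_trivial_subalgebra_of_kollar]). Hence [absurd] is inconsistent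
    ([absurd_inconsistent]). By contraction, elements below [e] are idempotent,
    which gives the deduction property that [G, a ⊢ b] implies
    [G ⊢ (e ⊓ a) ⇒ b] ([Rt_le]). So [v_1, ..., v_n] is refuted by the single
    formula [(e ⊓ v_1 ⊓ ... ⊓ v_n) ⇒ absurd] ([refuters_IL]). Weak excluded middle
    for this sequence reduces to the inequality
    [e ⊑ (x ⇒ absurd) ⊔ ((e ⊓ (x ⇒ absurd)) ⇒ absurd)], which is valid in all De
    Morgan monoids ([weak_excluded_middle]); its proof rests on the identity
    [f ⊗ f ⊗ f = f ⊗ f]. *)

Set Implicit Arguments.
Unset Strict Implicit.
Unset Printing Implicit Defensive.

Local Open Scope classical_set_scope.

Local Notation "x ⊑ y" := (leA x y) (at level 70, no associativity).
Local Notation "x ⊗ y" := (mul x y) (at level 40, left associativity).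
Local Notation "x ⊓ y" := (meet x y) (at level 45, left associativity).
Local Notation "x ⊔ y" := (join x y) (at level 50, left associativity).
Local Notation "∼ x" := (neg x) (at level 35, right associativity).

(** * De Morgan monoids *)

Definition imp (A : algebra) (x y : A) : A := ∼ (x ⊗ ∼ y).
Definition eqv (A : algebra) (x y : A) : A := imp x y ⊓ imp y x.

Local Notation "x ⇒ y" := (imp x y) (at level 55, right associativity).
Local Notation "x ⇔ y" := (eqv x y) (at level 56, no associativity).

(** The constant [e ⇔ f] with [f = ∼ e], which evaluates to [f ⊓ ∼ (f ⊗ f)]:
    it is designated exactly when [e = f], i.e., when [{e}] is a subalgebra. *)
Definition absurd (A : algebra) : A := cst ⇔ ∼ cst.
Arguments absurd {A}.

Section DMMTheory.
Variables (A : algebra) (dmA : DMM A).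
Implicit Types x y z w a : A.
Local Notation e := (@cst A).

Lemma le_refl x : x ⊑ x.
Proof. by rewrite /leA -{2}(joinKm dmA x x) (meetKj dmA). Qed.

Lemma le_trans y x z : x ⊑ y -> y ⊑ z -> x ⊑ z.
Proof. by rewrite /leA => xy yz; rewrite -{1}xy -(meetA dmA) yz. Qed.

Lemma le_anti x y : x ⊑ y -> y ⊑ x -> x = y.
Proof. by rewrite /leA => xy yx; rewrite -xy (meetC dmA) yx. Qed.

Lemma le_meetl x y : x ⊓ y ⊑ x.
Proof.
by rewrite /leA (meetC dmA) (meetA dmA); congr (_ ⊓ _); apply: le_refl.
Qed.

Lemma le_meetr x y : x ⊓ y ⊑ y.
Proof. by rewrite (meetC dmA); apply: le_meetl. Qed.

Lemma le_meet z x y : z ⊑ x -> z ⊑ y -> z ⊑ x ⊓ y.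
Proof. by rewrite /leA => zx zy; rewrite (meetA dmA) zx. Qed.

Lemma le_joinl x y : x ⊑ x ⊔ y.
Proof. exact: meetKj. Qed.

Lemma le_joinr x y : y ⊑ x ⊔ y.
Proof. by rewrite (joinC dmA); apply: le_joinl. Qed.

Lemma join_le x y z : x ⊑ z -> y ⊑ z -> x ⊔ y ⊑ z.
Proof.
move=> xz yz; rewrite /leA (meetC dmA) (meet_joinr dmA).
by rewrite ![z ⊓ _](meetC dmA) xz yz.
Qed.

Lemma mulx1 x : x ⊗ e = x.
Proof. by rewrite (mulC dmA) (mul1 dmA). Qed.

Lemma neg_le x y : x ⊑ y -> ∼ y ⊑ ∼ x.
Proof.
by move=> xy; have /(mul_le_neg dmA) : e ⊗ x ⊑ y; rewrite !(mul1 dmA).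
Qed.

Lemma neg_le_swap x y : ∼ x ⊑ y -> ∼ y ⊑ x.
Proof. by move/neg_le; rewrite (negK dmA). Qed.

Lemma le_imp x y z : x ⊗ y ⊑ z <-> x ⊑ y ⇒ z.
Proof.
by rewrite (mulC dmA) (mul_le_neg dmA); split=> /neg_le; rewrite !(negK dmA).
Qed.

Lemma mul_le_l x y z : x ⊑ y -> x ⊗ z ⊑ y ⊗ z.
Proof.
by move=> xy; apply/le_imp; apply: le_trans xy _; apply/le_imp; apply: le_refl.
Qed.

Lemma mul_le x x' y y' : x ⊑ x' -> y ⊑ y' -> x ⊗ y ⊑ x' ⊗ y'.
Proof.
move=> xx yy; apply: le_trans (mul_le_l _ xx) _.
by rewrite ![x' ⊗ _](mulC dmA); apply: mul_le_l.
Qed.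

Lemma mul_joinl x y z : (x ⊔ y) ⊗ z = x ⊗ z ⊔ y ⊗ z.
Proof.
apply: le_anti; last first.
  by apply: join_le; apply: mul_le_l; [apply: le_joinl|apply: le_joinr].
by apply/le_imp/join_le; apply/le_imp; [apply: le_joinl|apply: le_joinr].
Qed.

Lemma neg_join x y : ∼ (x ⊔ y) = ∼ x ⊓ ∼ y.
Proof.
apply: le_anti.
  by apply: le_meet; apply: neg_le; [apply: le_joinl|apply: le_joinr].
rewrite -[_ ⊓ _](negK dmA); apply: neg_le; apply: join_le.
  by rewrite -{1}(negK dmA x); apply/neg_le/le_meetl.
by rewrite -{1}(negK dmA y); apply/neg_le/le_meetr.
Qed.

Lemma neg_meet x y : ∼ (x ⊓ y) = ∼ x ⊔ ∼ y.
Proof. by rewrite -[RHS](negK dmA) neg_join !(negK dmA). Qed.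

Lemma mul_neg_le x y : x ⊗ ∼ (x ⊗ y) ⊑ ∼ y.
Proof. exact: (mul_le_neg dmA _ _ _).1 (le_refl _). Qed.

Lemma le_impE x y : x ⊑ y <-> e ⊑ x ⇒ y.
Proof. by rewrite -le_imp (mul1 dmA). Qed.

Lemma le_eqvE x y : e ⊑ x ⇔ y <-> x = y.
Proof.
split=> [exy|->]; last by apply: le_meet; exact: (le_impE _ _).1 (le_refl _).
apply: le_anti; apply: (le_impE _ _).2; apply: le_trans exy _.
- exact: le_meetl.
- exact: le_meetr.
Qed.

Lemma neg_cst_le_square : ∼ e ⊑ ∼ e ⊗ ∼ e.
Proof. exact: square_increasing. Qed.

(** The instance of contraction behind the excluded middle: [x ⊓ ∼ x] lies below
    its own square, hence below [x ⊗ ∼ x ⊑ f]. *)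
Lemma excluded_middle x : e ⊑ x ⊔ ∼ x.
Proof.
rewrite -[_ ⊔ _](negK dmA) -{1}(negK dmA e) neg_join (negK dmA x).
apply: neg_le.
apply: le_trans (square_increasing dmA _) _.
apply: le_trans (mul_le (le_meetr _ _) (le_meetl _ _)) _.
by have := mul_neg_le x e; rewrite mulx1 (mulC dmA).
Qed.

Lemma square_of_le_cst a : a ⊑ e -> a ⊗ a = a.
Proof.
move=> ae; apply: le_anti; last exact: square_increasing.
by rewrite -{3}(mulx1 a); apply: mul_le => //; apply: le_refl.
Qed.

(** Cubes of [f] collapse because [b := f ⇒ e] lies below [e], so that [b] is
    idempotent and [f ⊗ f ⊗ b] is the square of [f ⊗ b ⊑ e]. So [f ⊗ b ⊑ b],
    which is [f ⊗ f ⊗ f ⊑ f ⊗ f] by contraposition. *)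
Lemma neg_cst_cube : ∼ e ⊗ ∼ e ⊗ ∼ e = ∼ e ⊗ ∼ e.
Proof.
set f := ∼ e; set b := ∼ (f ⊗ f).
have fe : ∼ f = e by rewrite /f (negK dmA).
have bb : b ⊗ b = b.
  by apply: square_of_le_cst; apply: neg_le_swap; apply: neg_cst_le_square.
have fb : f ⊗ b ⊑ e by rewrite -fe; apply: mul_neg_le.
have ffb : f ⊗ f ⊗ b ⊑ e.
  rewrite -bb (mulA dmA) -(mulA dmA f f b) (mulC dmA f (f ⊗ b)).
  rewrite -(mulA dmA (f ⊗ b)) -(mul1 dmA e); exact: mul_le.
apply: le_anti; last by apply: mul_le_l; apply: neg_cst_le_square.
have bff : f ⊗ b ⊑ b.
  rewrite -(negK dmA (f ⊗ b)); apply: neg_le.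
  by apply: (mul_le_neg dmA f (f ⊗ b) e).1; rewrite (mulA dmA).
rewrite (mulC dmA) -(negK dmA (f ⊗ f)) -/b.
exact: (mul_le_neg dmA _ _ _).1 bff.
Qed.

Lemma absurdE : absurd = ∼ e ⊓ ∼ (∼ e ⊗ ∼ e) :> A.
Proof. by rewrite /absurd /eqv /imp !(negK dmA) (mul1 dmA). Qed.

Lemma imp_absurdE x : x ⇒ absurd = ∼ x ⊓ ∼ (x ⊗ (∼ e ⊗ ∼ e)).
Proof.
rewrite absurdE /imp neg_meet !(negK dmA) (mulC dmA) mul_joinl neg_join.
by rewrite (mul1 dmA) (mulC dmA x).
Qed.

Lemma le_cases y x z : x ⊑ e -> x ⊓ y ⊑ z -> x ⊓ ∼ y ⊑ z -> x ⊑ z.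
Proof.
move=> xe xyz xnyz; have <- : x ⊓ (y ⊔ ∼ y) = x.
  by apply: le_trans xe _; apply: excluded_middle.
by rewrite (meet_joinr dmA); apply: join_le.
Qed.

(** This is where the weak excluded middle law comes from: for [x ⊑ e], the
    element [e ⊓ (x ⇒ absurd)] is the pseudocomplement of [x] below [e] relative
    to [absurd], and together with its own pseudocomplement it covers [e].
    Write [f = ∼ e], [ff = f ⊗ f], [u = x ⇒ absurd] and [p = e ⊓ u], so that
    [u = ∼ x ⊓ ∼ (x ⊗ ff)] and [p ⇒ absurd = ∼ p ⊓ ∼ (p ⊗ ff)]. Ordinary
    excluded middle for [x] and for [x ⊗ ff] splits [e] into three parts. One
    lies below [u]. The other two lie below [x] and below [x ⊗ ff], and are
    shown to lie below [p ⇒ absurd] from [p ⊗ x ⊑ f], [p ⊗ (x ⊗ ff) ⊑ f] and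
    [ff ⊗ ff = ff]. *)
Lemma weak_excluded_middle x :
  e ⊑ (x ⇒ absurd) ⊔ (e ⊓ (x ⇒ absurd) ⇒ absurd).
Proof.
rewrite [e ⊓ _ ⇒ _]imp_absurdE imp_absurdE.
set ff := ∼ e ⊗ ∼ e; set u := _ ⊓ _; set p := e ⊓ u; set q := _ ⊓ _.
have ffff : ff ⊗ ff = ff.
  by rewrite {2}/ff (mulA dmA) neg_cst_cube neg_cst_cube.
have le_neg y z : y ⊗ z ⊑ ∼ e -> y ⊑ ∼ z.
  by move/le_imp; rewrite /imp (negK dmA) mulx1.
have neg_mul y z : y ⊑ ∼ z -> y ⊗ z ⊑ ∼ e.
  by move=> ?; apply/le_imp; rewrite /imp (negK dmA) mulx1.
have px : x ⊗ p ⊑ ∼ e.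
  rewrite (mulC dmA); apply: neg_mul.
  by apply: le_trans (le_meetr _ _) _; apply: le_meetl.
have pxff : x ⊗ ff ⊗ p ⊑ ∼ e.
  rewrite (mulC dmA); apply: neg_mul.
  by apply: le_trans (le_meetr _ _) _; apply: le_meetr.
apply: (le_cases (y := x)); first exact: le_refl.
  apply: le_trans (le_meetr _ _) _; apply: le_trans (le_joinr _ _).
  apply: le_meet; apply: le_neg => //.
  by rewrite (mulA dmA) -(mulA dmA) (mulC dmA p) (mulA dmA).
apply: (le_cases (y := x ⊗ ff)); first exact: le_meetl.
  apply: le_trans (le_meetr _ _) _; apply: le_trans (le_joinr _ _).
  apply: le_meet; apply: le_neg => //.
  by rewrite (mulC dmA p) (mulA dmA) -(mulA dmA x) ffff.
apply: le_trans (le_joinl _ _); apply: le_meet; last exact: le_meetr.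
by apply: le_trans (le_meetl _ _) _; apply: le_meetr.
Qed.

Lemma le_of_cover x y z : e ⊑ x ⊔ y -> e ⊓ x ⊑ z -> e ⊓ y ⊑ z -> e ⊑ z.
Proof.
move=> exy xz yz; have <- : e ⊓ (x ⊔ y) = e by exact: exy.
by rewrite (meet_joinr dmA); apply: join_le.
Qed.

Section Below.
Variables (a : A) (ae : a ⊑ e).

Let below x y := a ⊗ x ⊑ y.

Lemma below_trans y x z : below x y -> below y z -> below x z.
Proof.
rewrite /below => xy; apply: le_trans.
rewrite -{1}(square_of_le_cst ae) -(mulA dmA).
by apply: mul_le xy => //; apply: le_refl.
Qed.

Lemma below_mul x x' y y' : below x x' -> below y y' -> below (x ⊗ y) (x' ⊗ y').
Proof.
rewrite /below; have <- : (a ⊗ x) ⊗ (a ⊗ y) = a ⊗ (x ⊗ y).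
  rewrite (mulA dmA) -(mulA dmA a) (mulC dmA x) !(mulA dmA).
  by rewrite (square_of_le_cst ae).
exact: mul_le.
Qed.

Lemma below_meet x x' y y' :
  below x x' -> below y y' -> below (x ⊓ y) (x' ⊓ y').
Proof.
move=> xx yy; apply: le_meet.
  by apply: le_trans xx; apply: mul_le (le_refl _) (le_meetl _ _).
by apply: le_trans yy; apply: mul_le (le_refl _) (le_meetr _ _).
Qed.

Lemma below_join x x' y y' :
  below x x' -> below y y' -> below (x ⊔ y) (x' ⊔ y').
Proof.
move=> xx yy; rewrite /below (mulC dmA) mul_joinl !(mulC dmA _ a).
apply: join_le.
  by apply: le_trans xx _; apply: le_joinl.
by apply: le_trans yy _; apply: le_joinr.
Qed.

(** The congruence that makes [a] designated. Idempotence of [a] is what makes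
    it transitive and compatible with multiplication. *)
Definition cong_below : congruence A.
Proof.
exists (fun x y => below x y /\ below y x).
- by move=> x; split; rewrite /below -{2}(mul1 dmA x); apply: mul_le_l.
- by move=> x y [].
- by move=> x y z [xy yx] [yz zy]; split; apply: (below_trans (y := y)).
- by move=> x x' y y' [? ?] [? ?]; split; apply: below_mul.
- by move=> x x' y y' [? ?] [? ?]; split; apply: below_meet.
- by move=> x x' y y' [? ?] [? ?]; split; apply: below_join.
- by move=> x x' [? ?]; split; apply: (mul_le_neg dmA _ _ _).1.
Defined.

Lemma up_e_quotient x : up_e (quotient cong_below) (cls cong_below x) <-> a ⊑ x.
Proof.
have -> : up_e (quotient cong_below) (cls cong_below x) <->
    cong_below (e ⊓ x) e.
  by rewrite -cls_eqP; have /= -> := hom_meet (quot_hom cong_below) e x.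
split=> [[_]|ax].
  by rewrite /below mulx1 => aex; apply: le_trans aex _; apply: le_meetr.
split; rewrite /below ?mulx1; last exact: le_meet.
by have := mul_le ae (le_meetl e x); rewrite mulx1.
Qed.

End Below.

End DMMTheory.

(** * Homomorphisms, formulas and varieties *)

Section Homs.
Variables (A B : algebra) (h : hom A B).

Lemma hom_imp x y : h (x ⇒ y) = (h x ⇒ h y).
Proof. by rewrite /imp hom_neg hom_mul hom_neg. Qed.

Lemma hom_eqv x y : h (x ⇔ y) = (h x ⇔ h y).
Proof. by rewrite /eqv hom_meet !hom_imp. Qed.

End Homs.

Section Formulas.
Variable V : Type.
Local Notation Fmla := (Fm_alg V).

Lemma fm_eval_agree (A : algebra) (s s' : V -> A) (f : Fm V) :
  (forall x, fm_vars f x -> s x = s' x) -> fm_eval s f = fm_eval s' f.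
Proof.
elim: f => [x|f IHf g IHg|f IHf g IHg|f IHf g IHg|f IHf|] /= ss.
- exact: ss.
- by rewrite IHf ?IHg // => x ?; apply: ss; [right|left].
- by rewrite IHf ?IHg // => x ?; apply: ss; [right|left].
- by rewrite IHf ?IHg // => x ?; apply: ss; [right|left].
- by rewrite IHf.
- by [].
Qed.

Lemma hom_fm_eval (A : algebra) (h : hom Fmla A) (f : Fm V) :
  h f = fm_eval (fun x => h (fvar x)) f.
Proof.
elim: f => //= [f <- g <-|f <- g <-|f <- g <-|f <-|].
- exact: (hom_mul h f g).
- exact: (hom_meet h f g).
- exact: (hom_join h f g).
- exact: (hom_neg h f).
- exact: hom_cst.
Qed.

Lemma hom_comp_fm_eval (A B : algebra) (h : hom A B) (s : V -> A) (f : Fm V) :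
  h (fm_eval s f) = fm_eval (h \o s) f.
Proof.
elim: f => //= [f <- g <-|f <- g <-|f <- g <-|f <-|].
- exact: hom_mul.
- exact: hom_meet.
- exact: hom_join.
- exact: hom_neg.
- exact: hom_cst.
Qed.

Lemma fm_eval_eqv (A : algebra) (dmA : DMM A) (s : V -> A) (p q : Fm V) :
  leA cst (fm_eval s (@eqv Fmla p q)) <-> fm_eval s p = fm_eval s q.
Proof. exact: le_eqvE. Qed.

Lemma RtE (G : set (Fm V)) (a : Fm V) :
  Rt G a <-> forall A : algebra, DMM A -> forall s : V -> A,
    (forall b, G b -> leA cst (fm_eval s b)) -> leA cst (fm_eval s a).
Proof.
split=> [Ga A dmA s sG|Ga A dmA h hG].
  by apply: (Ga A dmA (fm_ext s)) => _ [b Gb <-]; apply: sG.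
rewrite /up_e /= hom_fm_eval; apply: Ga => // b Gb; rewrite -hom_fm_eval.
by apply: hG; exists b.
Qed.

Lemma is_filterE D (A : algebra) (F : set A) :
  is_filter D F <-> forall (G : set (Fm V)) a (s : V -> A), D G a ->
    (forall b, G b -> F (fm_eval s b)) -> F (fm_eval s a).
Proof.
split=> [FF G a s Ga sG|FF G a h Ga hG].
  by apply: (FF G a (fm_ext s) Ga) => _ [b Gb <-]; apply: sG.
rewrite hom_fm_eval; apply: FF Ga _ => b Gb; rewrite -hom_fm_eval.
by apply: hG; exists b.
Qed.

Lemma varietyE K : variety V K <->
  exists E : set (Fm V * Fm V), forall A,
    K A <-> forall p, E p -> forall s : V -> A, fm_eval s p.1 = fm_eval s p.2.
Proof.
split=> -[E KE]; exists E => A; split.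
- by move=> /KE EA [s t] Est a; apply: (EA s t Est (fm_ext a)).
- by move=> EA; apply/KE => s t Est h; rewrite !hom_fm_eval; apply: (EA (s, t)).
- by move=> /KE EA s t Est h; rewrite !hom_fm_eval; apply: (EA (s, t)).
- by move=> EA; apply/KE => -[s t] Est a; apply: (EA s t Est (fm_ext a)).
Qed.

Lemma cls_fm_eval (A : algebra) (t : congruence A) (s : V -> A) (f : Fm V) :
  cls t (fm_eval s f) = fm_eval (cls t \o s : V -> quotient t) f.
Proof. exact: (hom_comp_fm_eval (quot_hom t)). Qed.

Lemma cls_surj (A : algebra) (t : congruence A) (C : quotient t) :
  exists a, cls t a = C.
Proof. by case: C => S [a Sa]; exists a; apply: eq_exist. Qed.

Lemma variety_quotient K (A : algebra) (t : congruence A) :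
  variety V K -> K A -> K (quotient t).
Proof.
move=> /varietyE[E KE] /KE EA; apply/KE => p Ep s.
have [r rs] := choice (fun x => cls_surj (s x)).
have -> : s = cls t \o r by apply/funext => x; rewrite /= rs.
by rewrite -!cls_fm_eval (EA p Ep).
Qed.

(** * Kollár varieties *)

Section Compactness.
Variable A : algebra.
Implicit Types S T : set (congruence A).

Lemma cong_sup_mono S T : S `<=` T -> cong_le (cong_sup S) (cong_sup T).
Proof. by move=> ST x y Sxy t Tt; apply: Sxy => s /ST/Tt. Qed.

Definition finite_sup_rel S (x y : A) : Prop :=
  exists T, [/\ T `<=` S, finite_set T & cong_sup T x y].

(** The finite subfamilies of [S] are directed, so every closure property shared
    by all congruences passes to [finite_sup_rel S]. *)
Lemma finite_sup_rel2 S x x' y y' u w :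
  (forall t : congruence A, t x x' -> t y y' -> t u w) ->
  finite_sup_rel S x x' -> finite_sup_rel S y y' -> finite_sup_rel S u w.
Proof.
move=> tP [T [TS finT xx]] [T' [TS' finT' yy]]; exists (T `|` T'); split.
- by move=> t [/TS|/TS'].
- by rewrite finite_setU.
- apply: tP; first by apply: cong_sup_mono xx => t; left.
  by apply: cong_sup_mono yy => t; right.
Qed.

Lemma finite_sup_rel1 S x x' u w : (forall t : congruence A, t x x' -> t u w) ->
  finite_sup_rel S x x' -> finite_sup_rel S u w.
Proof.
by move=> tP xx; apply: (finite_sup_rel2 _ xx xx) => t + _; apply: tP.
Qed.

Definition finite_sup S : congruence A.
Proof.
exists (finite_sup_rel S).
- move=> x; exists set0; split=> //; exact: cong_refl.
- by move=> x y; apply: finite_sup_rel1 => t; apply: cong_sym.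
- by move=> x y z; apply: finite_sup_rel2 => t; apply: cong_trans.
- by move=> x x' y y'; apply: finite_sup_rel2 => t; apply: cong_mul.
- by move=> x x' y y'; apply: finite_sup_rel2 => t; apply: cong_meet.
- by move=> x x' y y'; apply: finite_sup_rel2 => t; apply: cong_join.
- by move=> x x'; apply: finite_sup_rel1 => t; apply: cong_neg.
Defined.

Lemma cong_sup_finite S x y : cong_sup S x y -> finite_sup_rel S x y.
Proof.
move=> /(_ (finite_sup S)); apply=> s Ss u w suw.
by exists [set s]; split=> [_ ->||t /(_ s erefl)] //; last apply.
Qed.

End Compactness.

(** In a De Morgan monoid [{e}] is a subalgebra exactly when [e = ∼ e], so this
    says that no nontrivial member has a trivial subalgebra. *)
Definition no_trivial_subalgebra (K : algebra -> Prop) : Prop :=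
  forall A : algebra, K A -> cst = ∼ cst :> A -> forall x : A, x = cst.

(** Congruence generation is finitary, so a family with total join has a finite
    subfamily whose join already identifies [e] with [∼ e]; the quotient by this
    join belongs to the variety, hence is trivial. *)
Lemma kollar_of_no_trivial_subalgebra K :
  variety V K -> no_trivial_subalgebra K -> kollar K.
Proof.
move=> varK trivK A KA S totS.
have [T [TS finT eT]] := cong_sup_finite (totS cst (∼ cst) I).
exists T; split=> // x y _; apply/cls_eqP.
have KQ : K (quotient (cong_sup T)) by apply: variety_quotient.
have ne : cst = ∼ cst :> quotient (cong_sup T).
  by have /= <- := hom_neg (quot_hom (cong_sup T)) cst; apply/cls_eqP.
by rewrite (trivK _ KQ ne (cls _ x)) (trivK _ KQ ne (cls _ y)).
Qed.

Section FiniteSupport.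
Variables (A : algebra) (dmA : DMM A) (ne : cst = ∼ cst :> A).

Definition eventually_cst (b : nat -> A) : Prop :=
  exists N, forall i, (N <= i)%N -> b i = cst.

Definition finsupp : Type := {b : nat -> A | eventually_cst b}.

Lemma eventually_cst1 (o : A -> A) (b : finsupp) :
  o cst = cst -> eventually_cst (fun i => o (sval b i)).
Proof. by case: b => b [N bN] oe; exists N => i Ni /=; rewrite bN. Qed.

Lemma eventually_cst2 (o : A -> A -> A) (b c : finsupp) :
  o cst cst = cst -> eventually_cst (fun i => o (sval b i) (sval c i)).
Proof.
case: b c => [b [N bN]] [c [M cM]] oe; exists (maxn N M) => i /=.
by rewrite geq_max => /andP[Ni Mi]; rewrite bN ?cM.
Qed.

Lemma join_cst : cst ⊔ cst = cst :> A.
Proof.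
by apply: le_anti => //; [apply: join_le => //; exact: le_refl|apply: le_joinl].
Qed.

(** The subalgebra of the power of [A] by [nat] formed by the sequences that are
    eventually [e]. It is closed under the operations because [{e}] is. *)
Definition finsupp_alg : algebra :=
  @Algebra finsupp
    (fun b c => exist _ _ (eventually_cst2 b c (mul1 dmA cst)))
    (fun b c => exist _ _ (eventually_cst2 b c (le_refl dmA cst)))
    (fun b c => exist _ _ (eventually_cst2 b c join_cst))
    (fun b => exist _ _ (eventually_cst1 b (esym ne)))
    (exist _ (fun=> cst) (ex_intro _ 0%N (fun _ _ => erefl))).

Definition finsupp_proj (i : nat) : hom finsupp_alg A :=
  @Hom finsupp_alg A (fun b => sval b i)
    (fun _ _ => erefl) (fun _ _ => erefl) (fun _ _ => erefl) (fun=> erefl) erefl.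

Lemma finsupp_eq (b c : finsupp_alg) :
  (forall i, finsupp_proj i b = finsupp_proj i c) -> b = c.
Proof. by case: b c => [b bP] [c cP] bc; apply/eq_exist/funext. Qed.

Lemma finsupp_variety K : variety V K -> K A -> K finsupp_alg.
Proof.
move=> /varietyE[E KE] /KE EA; apply/KE => p Ep s; apply: finsupp_eq => i.
by rewrite !hom_comp_fm_eval EA.
Qed.

Definition agree_from (N : nat) : congruence finsupp_alg.
Proof.
exists (fun b c => forall i, (N <= i)%N -> finsupp_proj i b = finsupp_proj i c).
- by [].
- by move=> b c bc i Ni; rewrite bc.
- by move=> b c d bc cd i Ni; rewrite bc ?cd.
- by move=> b b' c c' bb cc i Ni; rewrite !hom_mul bb ?cc.
- by move=> b b' c c' bb cc i Ni; rewrite !hom_meet bb ?cc.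
- by move=> b b' c c' bb cc i Ni; rewrite !hom_join bb ?cc.
- by move=> b b' bb i Ni; rewrite !hom_neg bb.
Defined.

(** The congruences [agree_from N] form a chain whose union is total. By
    compactness one of them is total; it then identifies the constant sequence
    [e] with the sequence that has [x] in place [N]. *)
Lemma compact_trivial :
  cong_compact (cong_total finsupp_alg) -> forall x : A, x = cst.
Proof.
move=> /(_ (range agree_from))[b c _ t St|T [Tr finT totT] x].
  have [[N bN] [M cM]] := (svalP b, svalP c).
  apply: (St (agree_from (maxn N M))) => [|i /=]; first by exists (maxn N M).
  by rewrite geq_max => /andP[Ni Mi]; rewrite bN ?cM.
have /choice[r rT] : forall t, exists N, T t -> t = agree_from N.
  move=> t; have [Tt|nTt] := pselect (T t); last by exists 0%N.
  by have [N _ <-] := Tr _ Tt; exists N.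
have /finite_fsetP[Y rTY] := finite_image r finT.
pose N := \max_(i <- Y) i.
have rN t : T t -> (r t <= N)%N.
  move=> Tt; apply: (leq_bigmax_seq (F := id)) => //.
  suff : [set` Y] (r t) by [].
  by rewrite -rTY; exists t.
have bP : eventually_cst (fun i => if i == N then x else cst).
  by exists N.+1 => i Ni; rewrite gtn_eqF.
have := totT (exist _ _ bP) cst I (agree_from N).
move=> /(_ _ N (leqnn N)) /=; rewrite eqxx; apply=> t Tt b c.
by rewrite (rT t Tt) => bc i /(leq_trans (rN t Tt)); apply: bc.
Qed.

End FiniteSupport.

Lemma no_trivial_subalgebra_of_kollar K : variety V K ->
  (forall A, K A -> DMM A) -> kollar K -> no_trivial_subalgebra K.
Proof.
move=> varK dmK kolK A KA ne.
apply: (compact_trivial (dmA := dmK A KA) (ne := ne)).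
by apply: kolK; apply: finsupp_variety.
Qed.

(** * De Morgan monoids form a variety *)

Section Variables.
Variables (v : nat -> V) (v_inj : injective v).

(** The variables outside the range of [v] get the value of [v 0]; only the
    values at the [v i] matter. *)
Definition assign (A : algebra) (xs : seq A) (w : V) : A :=
  nth cst xs (xget 0%N [set i | v i = w]).

Lemma assignE (A : algebra) (xs : seq A) i : assign xs (v i) = nth cst xs i.
Proof.
by rewrite /assign (@xget_unique _ 0%N _ i) //= => j; apply: v_inj.
Qed.

Local Notation X i := (@fvar V (v i)).

(** Residuation is an implication between equations. It follows from the
    identities [(x ⊔ y) ⊗ z = x ⊗ z ⊔ y ⊗ z] and [∼ (x ⊓ y) = ∼ x ⊔ ∼ y] (which
    make the operations monotone and antitone) and [x ⊗ ∼ (x ⊗ y) ⊑ ∼ y], so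
    De Morgan monoids are the models of the identities that they satisfy. *)
Lemma DMM_of_identities (A : algebra) :
  (forall p q : Fm V, (forall B, DMM B -> forall s : V -> B,
      fm_eval s p = fm_eval s q) ->
    forall s : V -> A, fm_eval s p = fm_eval s q) ->
  DMM A.
Proof.
move=> idA; pose x := X 0; pose y := X 1; pose z := X 2.
have asE a b c : (assign [:: a; b; c] (v 0) = a :> A) *
    ((assign [:: a; b; c] (v 1) = b) * (assign [:: a; b; c] (v 2) = c)).
  by rewrite !assignE.
have idE p q (a b c : A) : (forall B, DMM B -> forall s : V -> B,
    fm_eval s p = fm_eval s q) ->
    fm_eval (assign [:: a; b; c]) p = fm_eval (assign [:: a; b; c]) q.
  by move=> pq; apply: idA.
have mA : associative (@meet A).
  move=> a b c.
  have := idE (fmeet x (fmeet y z)) (fmeet (fmeet x y) z) a b c.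
  by rewrite /= !asE; apply=> B dmB s; apply: meetA.
have mC : commutative (@meet A).
  move=> a b; have := idE (fmeet x y) (fmeet y x) a b a.
  by rewrite /= !asE; apply=> B dmB s; apply: meetC.
have jA : associative (@join A).
  move=> a b c.
  have := idE (fjoin x (fjoin y z)) (fjoin (fjoin x y) z) a b c.
  by rewrite /= !asE; apply=> B dmB s; apply: joinA.
have jC : commutative (@join A).
  move=> a b; have := idE (fjoin x y) (fjoin y x) a b a.
  by rewrite /= !asE; apply=> B dmB s; apply: joinC.
have kj a b : a ⊓ (a ⊔ b) = a :> A.
  have := idE (fmeet x (fjoin x y)) x a b a.
  by rewrite /= !asE; apply=> B dmB s; apply: meetKj.
have km a b : a ⊔ (a ⊓ b) = a :> A.
  have := idE (fjoin x (fmeet x y)) x a b a.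
  by rewrite /= !asE; apply=> B dmB s; apply: joinKm.
have dist : right_distributive (@meet A) (@join A).
  move=> a b c.
  have := idE (fmeet x (fjoin y z)) (fjoin (fmeet x y) (fmeet x z)) a b c.
  by rewrite /= !asE; apply=> B dmB s; apply: meet_joinr.
have MA : associative (@mul A).
  move=> a b c; have := idE (fmul x (fmul y z)) (fmul (fmul x y) z) a b c.
  by rewrite /= !asE; apply=> B dmB s; apply: mulA.
have MC : commutative (@mul A).
  move=> a b; have := idE (fmul x y) (fmul y x) a b a.
  by rewrite /= !asE; apply=> B dmB s; apply: mulC.
have M1 : left_id cst (@mul A).
  move=> a; have := idE (fmul fcst x) x a a a.
  by rewrite /= !asE; apply=> B dmB s; apply: mul1.
have sq (a : A) : a ⊑ a ⊗ a.
  have := idE (fmeet x (fmul x x)) x a a a.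
  by rewrite /= !asE; apply=> B dmB s; apply: square_increasing.
have nK : involutive (@neg A).
  move=> a; have := idE (fneg (fneg x)) x a a a.
  by rewrite /= !asE; apply=> B dmB s; apply: negK.
have dm a b : ∼ (a ⊓ b) = ∼ a ⊔ ∼ b :> A.
  have := idE (fneg (fmeet x y)) (fjoin (fneg x) (fneg y)) a b a.
  by rewrite /= !asE; apply=> B dmB s; apply: neg_meet.
have mj a b c : (a ⊔ b) ⊗ c = a ⊗ c ⊔ b ⊗ c :> A.
  have := idE (fmul (fjoin x y) z) (fjoin (fmul x z) (fmul y z)) a b c.
  by rewrite /= !asE; apply=> B dmB s; apply: mul_joinl.
have mn (a b : A) : a ⊗ ∼ (a ⊗ b) ⊑ ∼ b.
  have := idE (fmeet (fmul x (fneg (fmul x y))) (fneg y))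
    (fmul x (fneg (fmul x y))) a b a.
  by rewrite /= !asE; apply=> B dmB s; apply: mul_neg_le.
have tr (a b c : A) : a ⊑ b -> b ⊑ c -> a ⊑ c.
  by rewrite /leA => ab bc; rewrite -{1}ab -mA bc.
have res (a b c : A) : a ⊗ b ⊑ c -> a ⊗ ∼ c ⊑ ∼ b.
  move=> abc; apply: tr (mn a b).
  have -> : ∼ (a ⊗ b) = ∼ (a ⊗ b) ⊔ ∼ c by rewrite -dm abc.
  by rewrite (MC a (_ ⊔ _)) mj !(MC _ a) jC /leA kj.
by split=> // a b c; split=> [/res //|/res]; rewrite !nK.
Qed.

(** * Algebraization *)

(** The De Morgan monoids in which the axioms [X] are designated. *)
Definition models (X : set (Fm V)) (A : algebra) : Prop :=
  DMM A /\ forall s : V -> A, forall a, X a -> leA cst (fm_eval s a).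

Lemma modelsE X A : models X A <-> forall p q, Rt X (@eqv Fmla p q) ->
  forall s : V -> A, fm_eval s p = fm_eval s q.
Proof.
split=> [[dmA XA] p q /RtE/(_ A dmA) pq s|EA].
  by apply/(le_eqvE dmA)/pq/XA.
have dmA : DMM A.
  apply: DMM_of_identities => p q pq; apply: EA; apply/RtE.
  by move=> B dmB s _; apply/(le_eqvE dmB)/pq.
split=> // s a Xa; apply: (EA (fmeet fcst a) fcst); apply/RtE => B dmB s' Xs'.
by apply/(le_eqvE dmB)/Xs'.
Qed.

Lemma models_variety X : variety V (models X).
Proof.
apply/varietyE; exists [set p | Rt X (@eqv Fmla p.1 p.2)] => A.
split=> [/modelsE EA [p q] /EA //|EA].
by apply/modelsE => p q pq; apply: (EA (p, q)).
Qed.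

Lemma DMM_quotient (A : algebra) (t : congruence A) : DMM A -> DMM (quotient t).
Proof.
move=> dmA; suff [] : models set0 (quotient t) by [].
by apply: variety_quotient; [apply: models_variety|split].
Qed.

(** Passing to the quotient by [cong_below] turns a premise [b] into the
    antecedent [e ⊓ b] of an implication. *)
Lemma Rt_le (G : set (Fm V)) (b c : Fm V) (A : algebra) (s : V -> A) :
  DMM A -> Rt (G `|` [set b]) c -> (forall a, G a -> leA cst (fm_eval s a)) ->
  leA (cst ⊓ fm_eval s b) (fm_eval s c).
Proof.
move=> dmA /RtE Gbc sG; have be := le_meetl dmA cst (fm_eval s b).
apply/(up_e_quotient dmA be); rewrite cls_fm_eval.
apply: Gbc => [|d Gd]; first exact: DMM_quotient.
rewrite -cls_fm_eval; apply/(up_e_quotient dmA be).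
case: Gd => [/sG|->]; last exact: le_meetr.
exact: le_trans (le_meetl _ _ _).
Qed.

Section Extension.
Variables (D : set (Fm V) -> Fm V -> Prop) (Ax : set (Fm V)).
Hypothesis dsD : deductive_system D.
Hypothesis AxD : forall G a, D G a <-> Rt (G `|` Ax) a.

Lemma Rt_weaken (G G' : set (Fm V)) a : G `<=` G' -> Rt G a -> Rt G' a.
Proof.
move=> GG /RtE Ga; apply/RtE => A dmA s sG; apply: Ga => // b Gb.
exact/sG/GG.
Qed.

Section Filter.
Variables (A : algebra) (F : set A).
Hypothesis FF : is_filter D F.

Lemma filter_Rt (G : set (Fm V)) a (s : V -> A) :
  Rt G a -> (forall b, G b -> F (fm_eval s b)) -> F (fm_eval s a).
Proof.
move=> Ga; have /is_filterE := FF; apply; apply/AxD.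
by apply: Rt_weaken Ga => b; left.
Qed.

(** As [x ⇔ y] is designated in a De Morgan monoid only if [x = y], every
    quasi-identity of De Morgan monoids becomes a closure property of filters
    on arbitrary algebras. *)
Lemma filter_quasi_identity (q1 q2 p : Fm V * Fm V) (s : V -> A) :
  (forall B, DMM B -> forall s' : V -> B, fm_eval s' q1.1 = fm_eval s' q1.2 ->
    fm_eval s' q2.1 = fm_eval s' q2.2 -> fm_eval s' p.1 = fm_eval s' p.2) ->
  F (fm_eval s q1.1 ⇔ fm_eval s q1.2) -> F (fm_eval s q2.1 ⇔ fm_eval s q2.2) ->
  F (fm_eval s p.1 ⇔ fm_eval s p.2).
Proof.
move=> qqp Fq1 Fq2.
pose G := [set @eqv Fmla q1.1 q1.2] `|` [set @eqv Fmla q2.1 q2.2].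
apply: (@filter_Rt G (@eqv Fmla p.1 p.2)) => [|b [->|->]] //.
apply/RtE => B dmB s' Gs'; apply/(le_eqvE dmB).
by apply: qqp => //; apply/(fm_eval_eqv dmB)/Gs'; [left|right].
Qed.

Lemma filter_eqv_refl x : F (x ⇔ x).
Proof.
have := @filter_Rt set0 (@eqv Fmla (X 0) (X 0)) (assign [:: x]).
rewrite /= assignE; apply=> //; apply/RtE => B dmB s _.
exact/(le_eqvE dmB).
Qed.

Definition filter_cong : congruence A.
Proof.
exists (fun x y => F (x ⇔ y)).
- exact: filter_eqv_refl.
- move=> x y xy; have := @filter_quasi_identity (X 0, X 1) (X 0, X 1)
    (X 1, X 0) (assign [:: x; y]).
  by rewrite /= !assignE; apply.
- move=> x y z xy yz; have := @filter_quasi_identity (X 0, X 1) (X 1, X 2)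
    (X 0, X 2) (assign [:: x; y; z]).
  by rewrite /= !assignE; apply=> // B _ s ->.
- move=> x x' y y' xx yy; have := @filter_quasi_identity (X 0, X 1) (X 2, X 3)
    (fmul (X 0) (X 2), fmul (X 1) (X 3)) (assign [:: x; x'; y; y']).
  by rewrite /= !assignE; apply=> // B _ s -> ->.
- move=> x x' y y' xx yy; have := @filter_quasi_identity (X 0, X 1) (X 2, X 3)
    (fmeet (X 0) (X 2), fmeet (X 1) (X 3)) (assign [:: x; x'; y; y']).
  by rewrite /= !assignE; apply=> // B _ s -> ->.
- move=> x x' y y' xx yy; have := @filter_quasi_identity (X 0, X 1) (X 2, X 3)
    (fjoin (X 0) (X 2), fjoin (X 1) (X 3)) (assign [:: x; x'; y; y']).
  by rewrite /= !assignE; apply=> // B _ s -> ->.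
- move=> x x' xx; have := @filter_quasi_identity (X 0, X 1) (X 0, X 1)
    (fneg (X 0), fneg (X 1)) (assign [:: x; x']).
  by rewrite /= !assignE; apply=> // B _ s ->.
Defined.

Lemma filter_cong_compatible : compatible F filter_cong.
Proof.
move=> x y xy Fx; have := @filter_Rt ([set X 0] `|` [set @eqv Fmla (X 0) (X 1)])
  (X 1) (assign [:: x; y]).
rewrite /= assignE; apply=> [|b [->|->]]; rewrite /= ?assignE //.
apply/RtE => B dmB s Gs.
rewrite -((fm_eval_eqv dmB _ _ _).1 (Gs _ (or_intror erefl))).
by apply: Gs; left.
Qed.

Lemma filter_cstE x : F x <-> F (cst ⊓ x ⇔ cst).
Proof.
split=> Fx.
  have := @filter_Rt [set X 0] (@eqv Fmla (fmeet fcst (X 0)) fcst)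
    (assign [:: x]).
  rewrite /= assignE; apply=> [|b ->]; rewrite /= ?assignE //.
  by apply/RtE => B dmB s Gs; apply/(fm_eval_eqv dmB)/(Gs (X 0)).
have := @filter_Rt [set @eqv Fmla (fmeet fcst (X 0)) fcst] (X 0)
  (assign [:: x]).
rewrite /= assignE; apply=> [|b ->]; rewrite /= ?assignE //.
apply/RtE => B dmB s Gs.
exact: (fm_eval_eqv dmB s (fmeet fcst (X 0)) fcst).1 (Gs _ erefl).
Qed.

(** The relation [x ⇔ y ∈ F] is a compatible congruence, and the largest one:
    a congruence that relates [x] and [y] relates [x ⇔ x ∈ F] to [x ⇔ y]. *)
Lemma leibniz_filterE x y : leibniz F x y <-> F (x ⇔ y).
Proof.
split=> [[t tF txy]|Fxy].
  apply: tF (filter_eqv_refl x).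
  by apply: cong_meet; apply/cong_neg/cong_mul => //;
    do ?[apply: cong_neg]; do ?[apply: cong_refl].
exact: (leibniz_largest filter_cong_compatible).
Qed.

End Filter.

(** The filter that corresponds to a congruence [t] is the preimage of the
    designated elements of the quotient by [t], and conversely a filter [F] is
    recovered from its Leibniz congruence as the set of all [x] for which
    [e ⊓ x] is congruent to [e]. *)
Lemma models_algebraize : algebraized D (models Ax).
Proof.
move=> A; split=> [F FF|F F' FF FF'|t Kt].
- apply/modelsE => p q pq s.
  have [r rs] := choice (fun x => cls_surj (s x)).
  have -> : s = cls (leibniz F) \o r by apply/funext => x; rewrite /= rs.
  rewrite -!cls_fm_eval; apply/cls_eqP/(leibniz_filterE FF).
  apply: ((is_filterE _ _).1 FF set0 (@eqv Fmla p q) r) => //; apply/AxD.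
  by apply: Rt_weaken pq => a; right.
- split=> [sub x y|sub x /(filter_cstE FF)/(leibniz_filterE FF)/sub].
    by move=> /(leibniz_filterE FF)/sub/(leibniz_filterE FF').
  by move=> /(leibniz_filterE FF'); apply: (filter_cstE FF' _).2.
- have [dmQ KQ] := Kt; pose F := [set x : A | up_e (quotient t) (cls t x)].
  have FF : is_filter D F.
    apply/is_filterE => G a s /AxD/RtE Ga sG.
    rewrite /F /= cls_fm_eval; apply: Ga => // b [/sG|Axb]; last exact: KQ.
    by rewrite /F /= cls_fm_eval.
  exists F => // x y; rewrite leibniz_filterE // /F /= -cls_eqP -(le_eqvE dmQ).
  by have /= -> := hom_eqv (quot_hom t) x y.
Qed.

(** * Inconsistency lemmas *)

Lemma subst_tupleE n (a : n.-tuple (Fm V)) i :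
  (i < n)%N -> subst_tuple v a (v i) = nth fcst a i.
Proof.
move=> ltin; rewrite /subst_tuple; case: pickP => [j /asboolP/v_inj <-|].
  exact: tnth_nth.
by move=> /(_ (Ordinal ltin)) /asboolP.
Qed.

Lemma fm_eval_subst (A : algebra) (s : V -> A) (r : V -> Fm V) (p : Fm V) :
  fm_eval s (fm_eval (r : V -> Fmla) p) = fm_eval (fun x => fm_eval s (r x)) p.
Proof. exact: (hom_comp_fm_eval (fm_ext s)). Qed.

(** Instantiation leaves the variables other than [v 0, ..., v n.-1] fixed but [r]
    may move them, so they must not occur in [p]. *)
Lemma fm_eval_inst n (a : n.-tuple (Fm V)) (r : V -> Fmla) (p : Fm V) :
  Fm_ v n p -> fm_eval r (fm_eval (subst_tuple v a : V -> Fmla) p) =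
  fm_eval (subst_tuple v (map_tuple (fm_eval r) a) : V -> Fmla) p.
Proof.
move=> pn; rewrite fm_eval_subst; apply: fm_eval_agree => x /pn[i /= ltin <-].
by rewrite !subst_tupleE // (nth_map fcst) ?size_tuple.
Qed.

Lemma inst_fset1 n (a : n.-tuple (Fm V)) (p : Fm V) :
  inst v [set` [fset p]%fset] a = [set fm_eval (subst_tuple v a : V -> Fmla) p].
Proof. by rewrite set_fset1 /inst image_set1. Qed.

Lemma fm_eval_trivial (A : algebra) (dmA : DMM A) (p : Fm V) :
  cst = ∼ cst :> A -> fm_eval (fun=> cst : A) p = cst.
Proof.
move=> ne; elim: p => //= [p -> q ->|p -> q ->|p -> q ->|p ->].
- exact: mul1.
- exact: le_refl.
- exact: join_cst.
- by [].
Qed.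

(** The set [G := Psi_1(e)] entails itself, so [G] together with [e] is a finite
    inconsistent set. By the lemma for its cardinality, inconsistency of a finite
    set is expressed by theorems and so survives substitution; putting [e] for
    all variables yields an inconsistent set of variable-free formulas. Where
    [{e}] is a subalgebra these formulas all take the value [e], so that every
    element is designated. *)
Lemma no_trivial_subalgebra_of_IL :
  has_IL v D -> no_trivial_subalgebra (models Ax).
Proof.
move=> [Psi PsiIL] A [dmA AxA] ne.
have [n [a n0 incons]] : exists n, exists2 a : n.-tuple (Fm V),
    (0 < n)%N & inconsistent D (set0 `|` [set` a]).
  pose G := inst v [set` Psi 1%N] [tuple fcst].
  have : inconsistent D (G `|` [set` [tuple fcst]]).
    by apply/(PsiIL 1%N isT).2 => b Gb; apply: ds_refl.
  have /finite_seqP[Y ->] : finite_set G by apply: finite_image.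
  move=> incons; exists (size (fcst :: Y)), (in_tuple (fcst :: Y)) => // b.
  apply: (ds_trans dsD) (incons b) => c Yc; apply: ds_refl => //.
  right; rewrite /= inE; case: Yc => /= [->|]; first by rewrite orbT.
  by rewrite inE => ->.
have [Psin PsinE] := PsiIL n n0; pose r (_ : V) : Fmla := fcst.
have : inconsistent D (set0 `|` [set` map_tuple (fm_eval r) a]).
  apply/PsinE => _ [p Psip <-]; rewrite /= -fm_eval_inst; last exact: Psin.
  rewrite -(image_set0 (fm_ext r)); apply: (ds_subst dsD (fm_ext r)).
  by have /PsinE := incons; apply; exists p.
move=> inconsr; have top (p : Fm V) (s : V -> A) : leA cst (fm_eval s p).
  have /AxD/RtE := inconsr p; apply=> // b [[//|]|Axb]; last exact: AxA.
  move=> /mapP[c _ ->]; rewrite fm_eval_subst fm_eval_trivial //.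
  exact: le_refl.
move=> x; have := top (X 0) (fun=> x); have := top (fneg (X 0)) (fun=> x).
move=> /= enx ex; apply: (le_anti dmA) => //; rewrite ne.
by rewrite -(negK dmA x); apply: neg_le.
Qed.

(** The theory generated by [absurd] is a filter of the formula algebra whose
    Leibniz quotient satisfies [e = ∼ e], hence is trivial. *)
Lemma absurd_inconsistent K : algebraized D K ->
  no_trivial_subalgebra K -> inconsistent D [set (absurd : Fmla)].
Proof.
move=> algK trivK; pose F := [set b : Fmla | D [set (absurd : Fmla)] b].
have FF : is_filter D F.
  apply/is_filterE => G b s Gb sG.
  apply: (ds_trans dsD) (ds_subst dsD (fm_ext s) Gb) => _ [c Gc <-].
  exact: sG.
have [/(_ F FF) KF _ _] := algK Fmla.
have ne : cst = ∼ cst :> quotient (leibniz F).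
  have /= <- := hom_neg (quot_hom (leibniz F)) cst; apply/cls_eqP.
  by apply/(leibniz_filterE FF)/(ds_refl dsD).
move=> b; have /cls_eqP := trivK _ KF ne (cls (leibniz F) b).
move=> /(cong_sym (c := leibniz F))/(leibniz_compatible (F := F)); apply.
apply: (filter_Rt FF (G := set0) (a := fcst) (s := @fvar V)) => //.
by apply/RtE => B dmB s _; apply: le_refl.
Qed.

Fixpoint conj (n : nat) : Fm V :=
  if n is m.+1 then fmeet (conj m) (X m) else fcst.

Section ConjEval.
Variables (A : algebra) (dmA : DMM A) (s : V -> A).

Lemma conj_le_cst n : leA (fm_eval s (conj n)) cst.
Proof.
elim: n => [|n IHn] /=; first exact: le_refl.
by apply: le_trans IHn => //; apply: le_meetl.
Qed.

Lemma conj_le n i : (i < n)%N -> leA (fm_eval s (conj n)) (s (v i)).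
Proof.
elim: n => // n IHn; rewrite ltnS leq_eqVlt => /orP[/eqP ->|/IHn ni] /=.
  exact: le_meetr.
by apply: le_trans ni => //; apply: le_meetl.
Qed.

Lemma cst_le_conj n :
  (forall i, (i < n)%N -> leA cst (s (v i))) -> fm_eval s (conj n) = cst.
Proof.
elim: n => // n IHn le /=; rewrite IHn => [|i /ltnW/le //]; exact: le.
Qed.

End ConjEval.

(** When [absurd] is inconsistent, the deduction property makes this formula
    express that its variables are jointly inconsistent. *)
Definition refuter (n : nat) : Fm V := @imp Fmla (conj n) absurd.

Lemma refuter_vars n : Fm_ v n (refuter n).
Proof.
have cn : fm_vars (conj n) `<=` [set v i | i in `I_n].
  elim: n => //= n IHn x [/IHn[i /= ltin <-]|->]; last by exists n => /=.
  by exists i => //=; apply: ltnW.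
by move=> x [/cn //|] /=; do !case.
Qed.

Definition refuters (n : nat) : {fset Fm V} := [fset refuter n]%fset.

Hypothesis absurdD : inconsistent D [set (absurd : Fmla)].

Lemma inconsistentE G : inconsistent D G <-> D G (absurd : Fmla).
Proof.
split=> [//|Gab b]; apply: (ds_trans dsD) (absurdD b) => _ -> //.
Qed.

Lemma subst_refuterE (A : algebra) (s : V -> A) n m (a : m.-tuple (Fm V)) :
  fm_eval s (fm_eval (subst_tuple v a : V -> Fmla) (refuter n)) =
  (fm_eval (fun x => fm_eval s (subst_tuple v a x)) (conj n) ⇒ absurd).
Proof. by rewrite fm_eval_subst. Qed.

Lemma subst_conj_le (A : algebra) (dmA : DMM A) (s : V -> A) n
    (a : n.-tuple (Fm V)) b : b \in a ->
  leA (fm_eval s (fm_eval (subst_tuple v a : V -> Fmla) (conj n))) (fm_eval s b).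
Proof.
move=> /tnthP[i ->]; rewrite fm_eval_subst.
apply: le_trans (conj_le dmA _ (ltn_ord i)) _ => //.
by rewrite subst_tupleE // -tnth_nth; apply: le_refl.
Qed.

Lemma refuters_IL : elementary_IL_sequence v D refuters.
Proof.
move=> n n0; split=> [p|G a].
  by rewrite set_fset1 => ->; apply: refuter_vars.
rewrite inst_fset1 inconsistentE; pose sa : V -> Fmla := subst_tuple v a.
have -> : entails D G [set fm_eval sa (refuter n)] <->
    D G (fm_eval sa (refuter n)).
  by split=> [|Gr _ -> //]; apply.
split=> /AxD Gab; apply/AxD/RtE => A dmA s sG.
  rewrite subst_refuterE; apply: (le_impE dmA _ _).1; rewrite -fm_eval_subst.
  apply: le_trans (le_meet dmA _ (le_refl dmA _)) _ => //.
    by rewrite fm_eval_subst; apply: conj_le_cst.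
  apply: (@Rt_le (G `|` Ax) _ (absurd : Fmla)) => //.
  apply/RtE => B dmB s' s'G; have /RtE := Gab; apply=> // b [[Gb|ab]|Axb].
  - by apply: s'G; left; left.
  - apply: le_trans (subst_conj_le dmB s' ab) => //.
    by apply: s'G; right.
  - by apply: s'G; left; right.
have /RtE/(_ A dmA s) := Gab; rewrite subst_refuterE cst_le_conj //.
  move=> /(_ _)/(le_impE dmA _ _).2; apply=> b [Gb|Axb].
    by apply: sG; left; left.
  by apply: sG; right.
move=> i ltin; rewrite subst_tupleE //; apply: sG; left; right.
by rewrite /= mem_nth // size_tuple.
Qed.

Lemma PsiPsi_refuters n : PsiPsi v refuters n =
  [set fm_eval (subst_tuple v [tuple refuter n] : V -> Fmla) (refuter 1)].
Proof.
rewrite /PsiPsi inst_fset1; congr [set _].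
have -> : (refuters n : seq (Fm V)) = [:: refuter n].
  apply: perm_small_eq => //; apply: uniq_perm => // [|x].
    exact: fset_uniq.
  by rewrite !inE.
by have -> : in_tuple [:: refuter n] = [tuple refuter n] by apply: val_inj.
Qed.

(** By the deduction property both premises give inequalities, and
    [weak_excluded_middle] says that their antecedents cover [e]. *)
Lemma refuters_WEML n (G : set (Fm V)) (a : n.-tuple (Fm V)) (f : Fm V) :
  D (G `|` inst v [set` refuters n] a) f ->
  D (G `|` inst v (PsiPsi v refuters n) a) f -> D G f.
Proof.
rewrite PsiPsi_refuters inst_fset1 /inst image_set1.
move=> /AxD Df1 /AxD Df2; apply/AxD/RtE => A dmA s sG.
have := weak_excluded_middle dmA
  (fm_eval (fun x => fm_eval s (subst_tuple v a x)) (conj n)).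
move=> /(le_of_cover dmA); apply; rewrite -subst_refuterE.
  by apply: (@Rt_le (G `|` Ax)) => //; rewrite setUAC.
have -> : (cst ⊓ fm_eval s (fm_eval (subst_tuple v a : V -> Fmla) (refuter n)) ⇒
    absurd) = fm_eval s (fm_eval (subst_tuple v a : V -> Fmla)
      (fm_eval (subst_tuple v [tuple refuter n] : V -> Fmla) (refuter 1))).
  by rewrite !(fm_eval_subst s) subst_refuterE /= subst_tupleE // fm_eval_subst.
by apply: (@Rt_le (G `|` Ax)) => //; rewrite setUAC.
Qed.

End Extension.
End Variables.
End Formulas.

Theorem theorem11p4 (V : Type) (v : nat -> V) (v_inj : injective v)
    (D : set (Fm V) -> Fm V -> Prop) :
  axiomatic_extension_of_Rt D ->
  (has_IL v D <-> has_WEML v D) /\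
  (has_IL v D <-> algebraized_by_kollar_variety_of_DMM D).
Proof.
move=> [dsD [Ax _ AxD]].
have IL_kollar : has_IL v D -> algebraized_by_kollar_variety_of_DMM D.
  move=> ilD; have varM := models_variety v_inj Ax.
  exists (models Ax); split=> //; first by move=> A [].
    apply: kollar_of_no_trivial_subalgebra varM _.
    exact: (no_trivial_subalgebra_of_IL v_inj dsD AxD ilD).
  exact: (models_algebraize v_inj AxD).
have kollar_WEML : algebraized_by_kollar_variety_of_DMM D -> has_WEML v D.
  move=> [K [varK dmK kolK algK]].
  have absurdD : inconsistent D [set (absurd : Fm_alg V)].
    apply: (absurd_inconsistent v_inj dsD AxD algK).
    exact: no_trivial_subalgebra_of_kollar varK dmK kolK.
  exists (refuters v); first exact: refuters_IL absurdD.
  by move=> n _ G a f; apply: refuters_WEML AxD n G a f.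
have WEML_IL : has_WEML v D -> has_IL v D by case=> Psi ilPsi _; exists Psi.
split; split=> //.
- by move/IL_kollar/kollar_WEML.
- by move/kollar_WEML/WEML_IL.
Qed.
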